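(* Let $\mathbb{F}$ be a field with $\mathrm{Char}(\mathbb{F})=3$. With the algebras $A_{1,3},\dots,A_{11,3}$ over $\mathbb{F}$ and the sets of matrices $Aut(A)$, $Der(A)$ as defined in the context, the following hold for all admissible values of the parameters. 1. $Aut(A_{1,3}(\alpha_1,\alpha_2,\alpha_4,\beta_1))=\{I\}$ and $Der(A_{1,3}(\alpha_1,\alpha_2,\alpha_4,\beta_1))=\{0\}$. 2. $Aut(A_{2,3}(\alpha_1,\alpha_4,\beta_2))=\{I\}$ and $Der(A_{2,3}(\alpha_1,\alpha_4,\beta_2))=\{0\}$. 3. If $\alpha_4\neq0$: $Aut(A_{3,3}(\alpha_1,\alpha_4,\beta_2))=\left\{\begin{pmatrix}1&0\\0&\pm1\end{pmatrix}\right\}$ and $Der(A_{3,3}(\alpha_1,\alpha_4,\beta_2))=\{0\}$. If $\beta_2\neq2\alpha_1-1$: $Aut(A_{3,3}(\alpha_1,0,\beta_2))=\left\{\begin{pmatrix}1&0\\0&d\end{pmatrix}: d\in\mathbb{F}^*\right\}$ and $Der(A_{3,3}(\alpha_1,0,\beta_2))=\left\{\begin{pmatrix}0&0\\0&d\end{pmatrix}: d\in\mathbb{F}\right\}$. $Aut(A_{3,3}(\alpha_1,0,2\alpha_1-1))=\left\{\begin{pmatrix}1&0\\c&d\end{pmatrix}: c,d\in\mathbb{F}, d\neq0\right\}$ and $Der(A_{3,3}(\alpha_1,0,2\alpha_1-1))=\left\{\begin{pmatrix}0&0\\c&d\end{pmatrix}: c,d\in\mathbb{F}\right\}$. 4.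 $Aut(A_{4,3}(\beta_1,\beta_2))=\{I\}$ and $Der(A_{4,3}(\beta_1,\beta_2))=\{0\}$. 5. $Aut(A_{5,3}(\alpha_1))=\left\{\begin{pmatrix}1&0\\c&1\end{pmatrix}: c\in\mathbb{F}\right\}$ and $Der(A_{5,3}(\alpha_1))=\left\{\begin{pmatrix}0&0\\c&0\end{pmatrix}: c\in\mathbb{F}\right\}$. 6. $Aut(A_{6,3}(\alpha_1,\alpha_4))=\{I\}$ and $Der(A_{6,3}(\alpha_1,\alpha_4))=\{0\}$. 7. If $\alpha_4\neq0$: $Aut(A_{7,3}(\alpha_1,\alpha_4))=\left\{\begin{pmatrix}1&0\\0&\pm1\end{pmatrix}\right\}$ and $Der(A_{7,3}(\alpha_1,\alpha_4))=\{0\}$. $Aut(A_{7,3}(\alpha_1,0))=\left\{\begin{pmatrix}1&0\\0&d\end{pmatrix}: d\in\mathbb{F}, d\neq0\right\}$ and $Der(A_{7,3}(\alpha_1,0))=\left\{\begin{pmatrix}0&0\\0&d\end{pmatrix}: d\in\mathbb{F}\right\}$. 8. $Aut(A_{8,3}(\beta_1))=\{I\}$ and $Der(A_{8,3}(\beta_1))=\{0\}$. 9. If $\beta_1\neq0,1,2$: $$Aut(A_{9,3}(\beta_1))=\{I\}\cup\left\{\begin{pmatrix}-d&\frac{-d(1+d)}{1+2d}\\\frac{2d^2-d-1}{d}&d\end{pmatrix}: d\in\mathbb{F},\ d\neq0,1,\ \beta_1=\frac{d^3-1}{d^3}\right\}.$$ $Aut(A_{9,3}(0))=\left\{\begin{pmatrix}1&b\\0&1\end{pmatrix}: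 b\in\mathbb{F}\right\}$; $Aut(A_{9,3}(1))=\left\{\begin{pmatrix}\frac{1+d}{2}&\frac{1-d}{2}\\1-d&d\end{pmatrix}: d\in\mathbb{F}\right\}$; $Aut(A_{9,3}(2))=\left\{I,\begin{pmatrix}1&0\\1&2\end{pmatrix}\right\}$; and for every $\beta_1\in\mathbb{F}$, $Der(A_{9,3}(\beta_1))=\left\{\begin{pmatrix}2b\beta_1&b\\2b\beta_1&b\beta_1\end{pmatrix}: b\in\mathbb{F}\right\}$. 10. If $\beta_1\neq0$: $Aut(A_{10,3}(\beta_1))=\left\{\begin{pmatrix}a&0\\0&a^2\end{pmatrix}: a\in\mathbb{F}, a^3=1\right\}\cup\left\{\begin{pmatrix}0&b\\1/b&0\end{pmatrix}: b\in\mathbb{F}, b\neq0, b^{-3}=\beta_1\right\}$ and $Der(A_{10,3}(\beta_1))=\left\{\begin{pmatrix}a&0\\0&-a\end{pmatrix}: a\in\mathbb{F}\right\}$. $Aut(A_{10,3}(0))=\left\{\begin{pmatrix}d^2&b\\0&d\end{pmatrix}: b,d\in\mathbb{F}, d\neq0\right\}$ and $Der(A_{10,3}(0))=\left\{\begin{pmatrix}a&b\\0&-a\end{pmatrix}: a,b\in\mathbb{F}\right\}$. 11. If $\beta_1\neq0$: $Aut(A_{11,3}(\beta_1))=\left\{\begin{pmatrix}\pm1&0\\0&1\end{pmatrix}\right\}$ and $Der(A_{11,3}(\beta_1))=\left\{\begin{pmatrix}0&\frac{2c}{\beta_1}\\c&0\end{pmatrix}: c\in\mathbb{F}\right\}$.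 $Aut(A_{11,3}(0))=\left\{\begin{pmatrix}a&b\\0&1\end{pmatrix}: a,b\in\mathbb{F}, a\neq0\right\}$ and $Der(A_{11,3}(0))=\left\{\begin{pmatrix}a&b\\0&0\end{pmatrix}: a,b\in\mathbb{F}\right\}$.
   Context: An algebra over $\mathbb{F}$ is a vector space with a bilinear multiplication (no associativity, commutativity or unit is assumed). A two-dimensional algebra with a fixed basis $e=(e_1,e_2)$ is identified with its matrix of structure constants $$A=\begin{pmatrix}\alpha_1&\alpha_2&\alpha_3&\alpha_4\\\beta_1&\beta_2&\beta_3&\beta_4\end{pmatrix},$$ meaning $e_1e_1=\alpha_1e_1+\beta_1e_2$, $e_1e_2=\alpha_2e_1+\beta_2e_2$, $e_2e_1=\alpha_3e_1+\beta_3e_2$, $e_2e_2=\alpha_4e_1+\beta_4e_2$; equivalently $(eu)\cdot(ev)=eA(u\otimes v)$ for column vectors $u,v\in\mathbb{F}^2$, where $\otimes$ is the Kronecker product. A linear map is identified with its matrix in the basis $e$, acting on column coordinate vectors (columns are the coordinates of the images of $e_1,e_2$). An automorphism is an invertible linear map $\mathbf{g}$ with $\mathbf{g}(\mathbf{u}\cdot\mathbf{v})=\mathbf{g}(\mathbf{u})\cdot\mathbf{g}(\mathbf{v})$; a derivation is a linear map $\mathbf{D}$ with $\mathbf{D}(\mathbf{u}\cdot\mathbf{v})=\mathbf{D}(\mathbf{u})\cdot\mathbf{v}+\mathbf{u}\cdot\mathbf{D}(\mathbf{v})$. Thus $Aut(A)=\{g\in GL(2,\mathbb{F}): gA=A(g\otimes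 g)\}$ and $Der(A)=\{D\in Mat(2;\mathbb{F}): DA=A(D\otimes I+I\otimes D)\}$, where $I$ is the $2\times2$ identity matrix. $\mathbb{F}^*=\mathbb{F}\setminus\{0\}$. The algebras (for $\mathrm{Char}(\mathbb{F})=3$): - $A_{1,3}(\alpha_1,\alpha_2,\alpha_4,\beta_1)=\begin{pmatrix}\alpha_1&\alpha_2&\alpha_2+1&\alpha_4\\\beta_1&-\alpha_1&1-\alpha_1&-\alpha_2\end{pmatrix}$, $(\alpha_1,\alpha_2,\alpha_4,\beta_1)\in\mathbb{F}^4$; - $A_{2,3}(\alpha_1,\alpha_4,\beta_2)=\begin{pmatrix}\alpha_1&0&0&\alpha_4\\1&\beta_2&1-\alpha_1&0\end{pmatrix}$, $(\alpha_1,\alpha_4,\beta_2)\in\mathbb{F}^3$, $\alpha_4\in\mathbb{F}^*$; - $A_{3,3}(\alpha_1,\alpha_4,\beta_2)=\begin{pmatrix}\alpha_1&0&0&\alpha_4\\0&\beta_2&1-\alpha_1&0\end{pmatrix}$, $(\alpha_1,\alpha_4,\beta_2)\in\mathbb{F}^3$; - $A_{4,3}(\beta_1,\beta_2)=\begin{pmatrix}0&1&1&0\\\beta_1&\beta_2&1&-1\end{pmatrix}$, $(\beta_1,\beta_2)\in\mathbb{F}^2$; - $A_{5,3}(\alpha_1)=\begin{pmatrix}\alpha_1&0&0&0\\1&2\alpha_1-1&1-\alpha_1&0\end{pmatrix}$, $\alpha_1\in\mathbb{F}$; - $A_{6,3}(\alpha_1,\alpha_4)=\begin{pmatrix}\alpha_1&0&0&\alpha_4\\1&1-\alpha_1&-\alpha_1&0\end{pmatrix}$,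 $(\alpha_1,\alpha_4)\in\mathbb{F}^2$, $\alpha_4\in\mathbb{F}^*$; - $A_{7,3}(\alpha_1,\alpha_4)=\begin{pmatrix}\alpha_1&0&0&\alpha_4\\0&1-\alpha_1&-\alpha_1&0\end{pmatrix}$, $(\alpha_1,\alpha_4)\in\mathbb{F}^2$; - $A_{8,3}(\beta_1)=\begin{pmatrix}0&1&1&0\\\beta_1&1&0&-1\end{pmatrix}$, $\beta_1\in\mathbb{F}$; - $A_{9,3}(\beta_1)=\begin{pmatrix}0&1&1&1\\\beta_1&0&0&-1\end{pmatrix}$, $\beta_1\in\mathbb{F}$; - $A_{10,3}(\beta_1)=\begin{pmatrix}0&0&0&1\\\beta_1&0&0&0\end{pmatrix}$, $\beta_1\in\mathbb{F}$; - $A_{11,3}(\beta_1)=\begin{pmatrix}0&1&1&0\\\beta_1&0&0&-1\end{pmatrix}$, $\beta_1\in\mathbb{F}$. *)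

(* Defs.v *)
From mathcomp Require Import all_boot all_order all_algebra.
From mathcomp Require Import classical_sets.
From mathcomp.real_closed Require Import mxtens.

Set Implicit Arguments.
Unset Strict Implicit.
Unset Printing Implicit Defensive.

Import GRing.Theory.
Local Open Scope ring_scope.
Local Open Scope classical_set_scope.

Section TwoDimensionalAlgebras.
Variable F : fieldType.

Definition mx22 (a b c d : F) : 'M[F]_2 :=
  \matrix_(i, j) (nth [::] [:: [:: a; b]; [:: c; d]] i)`_j.

(* Matrices of structure constants.  The columns are numbered as in [tensmx]:
   column [2 * i + j] holds the coordinates of the product of the [i]-th and
   [j]-th basis vectors (counted from 0), so that the product of the vectors
   with coordinate columns [u] and [v] is [A *m (u *t v)]. *)
Definition alg2 := 'M[F]_(2, 2 * 2).

Definition sc_mx (a1 a2 a3 a4 b1 b2 b3 b4 : F) : alg2 :=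
  \matrix_(i, j) (nth [::] [:: [:: a1; a2; a3; a4]; [:: b1; b2; b3; b4]] i)`_j.

Definition Aut (A : alg2) : set 'M[F]_2 :=
  [set g | g \in unitmx /\ g *m A = A *m (g *t g)].

Definition Der (A : alg2) : set 'M[F]_2 :=
  [set D | D *m A = A *m (D *t 1%:M + 1%:M *t D)].

Definition A1_3 (a1 a2 a4 b1 : F) :=
  sc_mx a1   a2   (a2 + 1)   a4
        b1 (- a1) (1 - a1) (- a2).

Definition A2_3 (a1 a4 b2 : F) :=
  sc_mx a1 0     0    a4
        1  b2 (1 - a1) 0.

Definition A3_3 (a1 a4 b2 : F) :=
  sc_mx a1 0     0    a4
        0  b2 (1 - a1) 0.

Definition A4_3 (b1 b2 : F) :=
  sc_mx 0  1  1   0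
        b1 b2 1 (- 1).

Definition A5_3 (a1 : F) :=
  sc_mx a1      0           0    0
        1  (2 * a1 - 1) (1 - a1) 0.

Definition A6_3 (a1 a4 : F) :=
  sc_mx a1    0       0   a4
        1  (1 - a1) (- a1) 0.

Definition A7_3 (a1 a4 : F) :=
  sc_mx a1    0       0   a4
        0  (1 - a1) (- a1) 0.

Definition A8_3 (b1 : F) :=
  sc_mx 0  1 1   0
        b1 1 0 (- 1).

Definition A9_3 (b1 : F) :=
  sc_mx 0  1 1   1
        b1 0 0 (- 1).

Definition A10_3 (b1 : F) :=
  sc_mx 0  0 0 1
        b1 0 0 0.

Definition A11_3 (b1 : F) :=
  sc_mx 0  1 1   0
        b1 0 0 (- 1).

End TwoDimensionalAlgebras.

(* Main.v *)
Require Import Defs.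
From mathcomp Require Import all_boot all_order all_algebra.
From mathcomp Require Import classical_sets.
From mathcomp Require Import mxtens ring.

(** For a matrix [g] with columns [g e1] and [g e2], being an automorphism
    means that eight polynomial equations hold between its entries and the
    structure constants ([Aut_mx22P]); being a derivation means that eight
    linear ones do ([Der_mx22P]).  The proof solves these systems, and what
    makes them easy to solve is a supply of invariants.

    Let [L_u] and [R_u] be the left and right multiplications by [u].  An
    automorphism conjugates [L_u] into [L_(g u)], hence preserves the linear
    forms [u |-> tr L_u] and [u |-> tr R_u] ([Aut_trace]) and the quadratic
    form [u |-> det L_u] ([Aut_det]); a derivation maps [L_u] to the
    commutator [L_(D u) = D L_u - L_u D], so the two trace forms vanish on its
    image ([Der_trace]).

    For the first algebra the two trace forms are the two coordinates, which
    leaves only the identity and the zero derivation.  For the next seven, one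
    trace form is the first coordinate: the first row of [g] is [1 0], that of
    [D] is [0 0], and the remaining equations are almost linear in the second
    row.  Five of these seven algebras are members of one family, solved once
    and for all in [Aut_lowerP] and [Der_lowerP].

    The last three algebras have zero trace forms.  The tenth has so few
    nonzero constants that its equations can be solved directly.  For the ninth
    and the eleventh, unless the parameter is 0, the quadratic form [det L_u]
    takes over.  In the ninth one, when the parameter is neither 0 nor 1, this
    form is nondegenerate, so [g] is an isometry of determinant 1 or -1.  An
    isometry satisfies [M g = det g * (adj g)^T M] for the Gram matrix [M];
    these equations are linear in [g] once the sign of [det g] is known.
    Determinant 1 then gives the identity, and determinant -1 gives the second
    family of solutions. *)

Import GRing.Theory.
Local Open Scope ring_scope.
Local Open Scope classical_set_scope.

Set Implicit Arguments.
Unset Strict Implicit.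
Unset Printing Implicit Defensive.

(** * Linear combinations of equations, modulo 3 *)

Section LinearCombinations.
Variable F : fieldType.
Implicit Types p q k l r : F.

Lemma eq_add l r l' r' : l = r -> l' = r' -> l + l' = r + r'.
Proof. by move=> -> ->. Qed.

Lemma eq_scale k l r : l = r -> k * l = k * r.
Proof. by move=> ->. Qed.

Lemma eq_from p q l r : l = r -> p - q = l - r -> p = q.
Proof. by move=> ->; rewrite subrr => /subr0_eq. Qed.

End LinearCombinations.

(** A linear combination of hypotheses is written as a term: [e1 +' k *' e2] is
    the equation obtained from [e1] by adding [k] times [e2]. *)
Notation "e +' f" := (eq_add e f)
  (at level 50, left associativity, only parsing).
Notation "k *' e" := (eq_scale k e)
  (at level 40, left associativity, only parsing).

Section Characteristic3.
Variables (F : fieldType) (h3 : 3 = 0 :> F).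

Lemma char3_mul n : (3 * n)%:R = 0 :> F.
Proof. by rewrite natrM h3 mul0r. Qed.

Lemma char3_mulN n : - (3 * n)%:R = 0 :> F.
Proof. by rewrite char3_mul oppr0. Qed.

End Characteristic3.

(** The normal form of a polynomial identity that holds in characteristic 3
    is zero up to monomials whose coefficient is a multiple of 3.  A rewriting
    hypothesis given to [ring] erases a coefficient only when it is equal to
    the left-hand side, which is why each multiple is listed. *)
Ltac ring3 :=
  match goal with
  | h3 : 3 = 0 :> _ |- _ =>
    apply: subr0_eq;
    ring: h3 (char3_mulN h3 1 : - 3 = 0)
      (char3_mul h3 2 : 6 = 0) (char3_mulN h3 2 : - 6 = 0)
      (char3_mul h3 3 : 9 = 0) (char3_mulN h3 3 : - 9 = 0)
      (char3_mul h3 4 : 12 = 0) (char3_mulN h3 4 : - 12 = 0)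
  | _ => ring
  end.

Ltac field3 :=
  match goal with
  | h3 : 3 = 0 :> _ |- _ =>
    apply: subr0_eq;
    field: h3 (char3_mulN h3 1 : - 3 = 0)
      (char3_mul h3 2 : 6 = 0) (char3_mulN h3 2 : - 6 = 0)
      (char3_mul h3 3 : 9 = 0) (char3_mulN h3 3 : - 9 = 0)
      (char3_mul h3 4 : 12 = 0) (char3_mulN h3 4 : - 12 = 0)
      (char3_mul h3 5 : 15 = 0) (char3_mulN h3 5 : - 15 = 0)
      (char3_mul h3 6 : 18 = 0) (char3_mulN h3 6 : - 18 = 0)
      (char3_mul h3 7 : 21 = 0) (char3_mulN h3 7 : - 21 = 0)
  end.

(** Closes [p = q] when [p - q] is the difference of the two sides of the given
    combination. *)
Tactic Notation "from" uconstr(pf) := refine (eq_from pf _); ring3.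

(** * Equations in coordinates *)

Section Coordinates.
Variable F : fieldType.
Implicit Types a b c d x y : F.

Lemma mx22_eta (g : 'M[F]_2) : g = mx22 (g 0 0) (g 0 1) (g 1 0) (g 1 1).
Proof.
apply/matrixP => -[[|[|//]] ilt] [[|[|//]] jlt]; rewrite mxE /=;
  by congr (g _ _); apply: val_inj.
Qed.

Lemma mx22_inj a b c d a' b' c' d' :
  mx22 a b c d = mx22 a' b' c' d' -> [/\ a = a', b = b', c = c' & d = d'].
Proof.
move=> /matrixP E.
by move: (E 0 0) (E 0 1) (E 1 0) (E 1 1); rewrite !mxE.
Qed.

Lemma mx22_1 : 1%:M = mx22 1 0 0 1 :> 'M[F]_2.
Proof. by rewrite [LHS]mx22_eta !mxE. Qed.

Lemma mx22_0 : 0 = mx22 0 0 0 0 :> 'M[F]_2.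
Proof. by rewrite [LHS]mx22_eta !mxE. Qed.

Lemma mx22_unit a b c d : (mx22 a b c d \in unitmx) = (a * d - b * c != 0).
Proof.
rewrite unitmxE unitfE (expand_det_row _ 0) !big_ord_recl big_ord0 /cofactor.
rewrite !det_mx11 !mxE /= expr0 expr1 addr0; congr (_ != 0); ring.
Qed.

Lemma eq_mx22_set (S T : set 'M[F]_2) :
  (forall a b c d, S (mx22 a b c d) <-> T (mx22 a b c d)) -> S = T.
Proof. by move=> ST; apply/seteqP; split=> g; rewrite (mx22_eta g) => /ST. Qed.

Lemma sc_mx_eqP (p1 p2 p3 p4 q1 q2 q3 q4 p1' p2' p3' p4' q1' q2' q3' q4' : F) :
  sc_mx p1 p2 p3 p4 q1 q2 q3 q4 =
    sc_mx p1' p2' p3' p4' q1' q2' q3' q4' <->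
  [/\ p1 = p1', p2 = p2', p3 = p3' & p4 = p4'] /\
  [/\ q1 = q1', q2 = q2', q3 = q3' & q4 = q4'].
Proof.
split=> [/matrixP E | [[-> -> -> ->] [-> -> -> ->]] //].
have e i j (ilt : (i < 2)%N) (jlt : (j < 2 * 2)%N) :=
  E (Ordinal ilt) (Ordinal jlt).
move: (e 0%N 0%N isT isT) (e 0%N 1%N isT isT).
move: (e 0%N 2%N isT isT) (e 0%N 3%N isT isT).
move: (e 1%N 0%N isT isT) (e 1%N 1%N isT isT).
move: (e 1%N 2%N isT isT) (e 1%N 3%N isT isT).
by rewrite !mxE.
Qed.

Variables p1 p2 p3 p4 q1 q2 q3 q4 : F.
Local Notation A := (sc_mx p1 p2 p3 p4 q1 q2 q3 q4).

Lemma mx22_mul_sc a b c d : mx22 a b c d *m A =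
  sc_mx (a * p1 + b * q1) (a * p2 + b * q2) (a * p3 + b * q3) (a * p4 + b * q4)
        (c * p1 + d * q1) (c * p2 + d * q2) (c * p3 + d * q3) (c * p4 + d * q4).
Proof.
apply/matrixP => -[[|[|//]] ilt] [[|[|[|[|//]]]] jlt];
  by rewrite !mxE !big_ord_recl big_ord0 !mxE /= addr0.
Qed.

Lemma sc_mul_mx (M : 'M[F]_(2 * 2)) :
  let m i j := M (mxtens_index (i, j)) in
  A *m M = \matrix_(i, j) (A i (mxtens_index (0, 0)) * m 0 0 j
    + A i (mxtens_index (0, 1)) * m 0 1 j + A i (mxtens_index (1, 0)) * m 1 0 j
    + A i (mxtens_index (1, 1)) * m 1 1 j).
Proof.
move=> m; apply/matrixP => i j; rewrite [LHS]mxE [RHS]mxE.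
rewrite (eq_bigr (fun k : 'I_4 => A i k * M k j)) //.
rewrite !big_ord_recl big_ord0 addr0 !addrA.
by congr (_ + _ + _ + _); congr (_ * _); rewrite ?/m; congr fun_of_matrix;
  apply: val_inj.
Qed.

(** The eight equations express [g (ei ej) = g ei * g ej], coordinate by
    coordinate, with [(i, j)] running through 11, 12, 21, 22.  Hypotheses named
    [xij] and [yij] below refer to the first and second coordinates. *)
Lemma Aut_mx22P a b c d : Aut A (mx22 a b c d) <->
  [/\ a * d - b * c != 0,
      [/\ a * p1 + b * q1 = p1 * a * a + p2 * a * c + p3 * c * a + p4 * c * c,
          a * p2 + b * q2 = p1 * a * b + p2 * a * d + p3 * c * b + p4 * c * d,
          a * p3 + b * q3 = p1 * b * a + p2 * b * c + p3 * d * a + p4 * d * c &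
          a * p4 + b * q4 = p1 * b * b + p2 * b * d + p3 * d * b + p4 * d * d] &
      [/\ c * p1 + d * q1 = q1 * a * a + q2 * a * c + q3 * c * a + q4 * c * c,
          c * p2 + d * q2 = q1 * a * b + q2 * a * d + q3 * c * b + q4 * c * d,
          c * p3 + d * q3 = q1 * b * a + q2 * b * c + q3 * d * a + q4 * d * c &
          c * p4 + d * q4 = q1 * b * b + q2 * b * d + q3 * d * b + q4 * d * d]].
Proof.
rewrite /Aut /= mx22_unit mx22_mul_sc.
have -> : A *m (mx22 a b c d *t mx22 a b c d) =
  sc_mx (p1 * a * a + p2 * a * c + p3 * c * a + p4 * c * c)
        (p1 * a * b + p2 * a * d + p3 * c * b + p4 * c * d)
        (p1 * b * a + p2 * b * c + p3 * d * a + p4 * d * c)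
        (p1 * b * b + p2 * b * d + p3 * d * b + p4 * d * d)
        (q1 * a * a + q2 * a * c + q3 * c * a + q4 * c * c)
        (q1 * a * b + q2 * a * d + q3 * c * b + q4 * c * d)
        (q1 * b * a + q2 * b * c + q3 * d * a + q4 * d * c)
        (q1 * b * b + q2 * b * d + q3 * d * b + q4 * d * d).
  rewrite sc_mul_mx; apply/matrixP => -[[|[|//]] ilt] [[|[|[|[|//]]]] jlt];
    by rewrite !mxE /=; ring.
rewrite sc_mx_eqP; by split=> [[? []] | []].
Qed.

(** The equations of [D (ei ej) = D ei * ej + ei * D ej], in the same order. *)
Lemma Der_mx22P a b c d : Der A (mx22 a b c d) <->
  [/\ a * p1 + b * q1 = p1 * a + p3 * c + (p1 * a + p2 * c),
      a * p2 + b * q2 = p2 * a + p4 * c + (p1 * b + p2 * d),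
      a * p3 + b * q3 = p1 * b + p3 * d + (p3 * a + p4 * c) &
      a * p4 + b * q4 = p2 * b + p4 * d + (p3 * b + p4 * d)] /\
  [/\ c * p1 + d * q1 = q1 * a + q3 * c + (q1 * a + q2 * c),
      c * p2 + d * q2 = q2 * a + q4 * c + (q1 * b + q2 * d),
      c * p3 + d * q3 = q1 * b + q3 * d + (q3 * a + q4 * c) &
      c * p4 + d * q4 = q2 * b + q4 * d + (q3 * b + q4 * d)].
Proof.
rewrite /Der /= mx22_mul_sc -sc_mx_eqP.
set B := (X in _ <-> _ = X).
suff -> : A *m (mx22 a b c d *t 1%:M + 1%:M *t mx22 a b c d) = B by [].
rewrite sc_mul_mx mx22_1; apply/matrixP => -[[|[|//]] ilt] [[|[|[|[|//]]]] jlt];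
  by rewrite !mxE /=; ring.
Qed.

(** * Invariants *)

(** The equations say that [L_(g u) g = g L_u] for [u = e1, e2], and likewise
    for [R].  Multiplying by the adjugate of [g] and taking traces gives
    [det g * tr L_(g u) = det g * tr L_u], whence the coefficients below. *)
Lemma Aut_trace a b c d : Aut A (mx22 a b c d) ->
  [/\ (p1 + q2) * a + (p3 + q4) * c = p1 + q2,
      (p1 + q2) * b + (p3 + q4) * d = p3 + q4,
      (p1 + q3) * a + (p2 + q4) * c = p1 + q3 &
      (p1 + q3) * b + (p2 + q4) * d = p2 + q4].
Proof.
case/Aut_mx22P=> D0 [x11 x12 x21 x22] [y11 y12 y21 y22].
split; apply: (mulfI D0).
- by from ((- d) *' x11 +' c *' x12 +' b *' y11 +' (- a) *' y12).
- by from ((- d) *' x21 +' c *' x22 +' b *' y21 +' (- a) *' y22).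
- by from ((- d) *' x11 +' c *' x21 +' b *' y11 +' (- a) *' y21).
- by from ((- d) *' x12 +' c *' x22 +' b *' y12 +' (- a) *' y22).
Qed.

(** Taking determinants in [L_(g u) g = g L_u] shows that [det L_u] is an
    invariant quadratic form. *)
Lemma Aut_det a b c d : Aut A (mx22 a b c d) -> forall x y,
  let det_lmul x y :=
    (p1 * x + p3 * y) * (q2 * x + q4 * y) -
    (p2 * x + p4 * y) * (q1 * x + q3 * y) in
  det_lmul (a * x + b * y) (c * x + d * y) = det_lmul x y.
Proof.
case/Aut_mx22P=> D0 [x11 x12 x21 x22] [y11 y12 y21 y22] x y /=.
set u := a * x + b * y; set v := c * x + d * y.
(* the four entries of [L_(g w) g = g L_w] for [w = (x, y)] *)
have e11 : (p1 * u + p3 * v) * a + (p2 * u + p4 * v) * c =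
           a * (p1 * x + p3 * y) + b * (q1 * x + q3 * y).
  by rewrite /u /v; from ((- x) *' x11 +' (- y) *' x21).
have e12 : (p1 * u + p3 * v) * b + (p2 * u + p4 * v) * d =
           a * (p2 * x + p4 * y) + b * (q2 * x + q4 * y).
  by rewrite /u /v; from ((- x) *' x12 +' (- y) *' x22).
have e21 : (q1 * u + q3 * v) * a + (q2 * u + q4 * v) * c =
           c * (p1 * x + p3 * y) + d * (q1 * x + q3 * y).
  by rewrite /u /v; from ((- x) *' y11 +' (- y) *' y21).
have e22 : (q1 * u + q3 * v) * b + (q2 * u + q4 * v) * d =
           c * (p2 * x + p4 * y) + d * (q2 * x + q4 * y).
  by rewrite /u /v; from ((- x) *' y12 +' (- y) *' y22).
apply: (mulfI D0).
set l11 := p1 * u + _ in e11 e12 *; set l12 := p2 * u + _ in e11 e12 *.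
set l21 := q1 * u + _ in e21 e22 *; set l22 := q2 * u + _ in e21 e22 *.
transitivity ((l11 * a + l12 * c) * (l21 * b + l22 * d) -
              (l11 * b + l12 * d) * (l21 * a + l22 * c)); first by ring.
by rewrite e11 e12 e21 e22; ring.
Qed.

(** The equations say that [L_(D u) = D L_u - L_u D], and a commutator has
    trace zero; likewise for [R]. *)
Lemma Der_trace a b c d : Der A (mx22 a b c d) ->
  [/\ (p1 + q2) * a + (p3 + q4) * c = 0,
      (p1 + q2) * b + (p3 + q4) * d = 0,
      (p1 + q3) * a + (p2 + q4) * c = 0 &
      (p1 + q3) * b + (p2 + q4) * d = 0].
Proof.
case/Der_mx22P=> [[x11 x12 x21 x22] [y11 y12 y21 y22]].
split.
- by from ((-1) *' x11 +' (-1) *' y12).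
- by from ((-1) *' x21 +' (-1) *' y22).
- by from ((-1) *' x11 +' (-1) *' y21).
- by from ((-1) *' x12 +' (-1) *' y22).
Qed.
End Coordinates.

Ltac in_Aut := apply/Aut_mx22P; split; [ | split; ring3 | split; ring3].
Ltac in_Der := apply/Der_mx22P; split; split; ring3.

(** * Algebras with a nonzero trace form *)

Section Parts.
Variable F : fieldType.
Hypothesis h3 : 3 = 0 :> F.
Implicit Types a b c d : F.

Lemma det_1_0_c_d c d : (1 * d - 0 * c != 0) = (d != 0).
Proof. by rewrite mul1r mul0r subr0. Qed.

Lemma Aut_row1 (p1 p2 p3 p4 q1 q2 q3 q4 a b c d : F) :
  [/\ p1 + q2 = 1 & p3 + q4 = 0] \/ [/\ p1 + q3 = 1 & p2 + q4 = 0] ->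
  Aut (sc_mx p1 p2 p3 p4 q1 q2 q3 q4) (mx22 a b c d) -> a = 1 /\ b = 0.
Proof.
move=> tr /Aut_trace[]; case: tr => -[-> ->].
  by rewrite !mul1r !mul0r !addr0 => -> ->.
by move=> _ _; rewrite !mul1r !mul0r !addr0 => -> ->.
Qed.

Lemma Der_row1 (p1 p2 p3 p4 q1 q2 q3 q4 a b c d : F) :
  [/\ p1 + q2 = 1 & p3 + q4 = 0] \/ [/\ p1 + q3 = 1 & p2 + q4 = 0] ->
  Der (sc_mx p1 p2 p3 p4 q1 q2 q3 q4) (mx22 a b c d) -> a = 0 /\ b = 0.
Proof.
move=> tr /Der_trace[]; case: tr => -[-> ->].
  by rewrite !mul1r !mul0r !addr0 => -> ->.
by move=> _ _; rewrite !mul1r !mul0r !addr0 => -> ->.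
Qed.

Lemma Aut_A1 a1 a2 a4 b1 : Aut (A1_3 a1 a2 a4 b1) = [set 1%:M].
Proof.
rewrite mx22_1; apply: eq_mx22_set => a b c d; split.
  case/Aut_trace => r1 r2 r3 r4; congr mx22.
  - by from r3.
  - by from r4.
  - by from r1.
  - by from r2.
case/mx22_inj => -> -> -> ->; in_Aut; by rewrite det_1_0_c_d oner_eq0.
Qed.

Lemma Der_A1 a1 a2 a4 b1 : Der (A1_3 a1 a2 a4 b1) = [set 0].
Proof.
rewrite mx22_0; apply: eq_mx22_set => a b c d; split.
  case/Der_trace => r1 r2 r3 r4; congr mx22.
  - by from r3.
  - by from r4.
  - by from r1.
  - by from r2.
by case/mx22_inj => -> -> -> ->; in_Der.
Qed.

Lemma mulf_eq0l (p c : F) : p != 0 -> p * c = 0 -> c = 0.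
Proof. by move=> p0 /eqP; rewrite mulf_eq0 (negPf p0) => /eqP. Qed.

Lemma sqr_eq1 d : d ^+ 2 - 1 = 0 -> d = 1 \/ d = - 1.
Proof.
by move/subr0_eq/eqP; rewrite sqrf_eq1 => /orP[] /eqP; [left | right].
Qed.

Lemma oppr1_neq0 : (- 1 : F) != 0.
Proof. by rewrite oppr_eq0 oner_eq0. Qed.

Section LowerTriangular.
Variables p1 p4 q1 q2 q3 : F.
Hypothesis tr1 : p1 + q2 = 1 \/ p1 + q3 = 1.

(** The algebras where [e2] spans a line stable under multiplication by [e1]
    on both sides, and [e2 e2] is a multiple of [e1].  The last equation is
    the [e2]-coordinate of [(e1 + c e2)^2 = g (e1 e1)]; when [p4 = q1 = 0], its
    coefficient [q2 + q3 - p1] decides whether [c] is free. *)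
Lemma Aut_lowerP a b c d : Aut (sc_mx p1 0 0 p4 q1 q2 q3 0) (mx22 a b c d) <->
  [/\ a = 1, b = 0 & d != 0] /\
  [/\ p4 * c = 0, p4 * (d ^+ 2 - 1) = 0 & (q2 + q3 - p1) * c = (d - 1) * q1].
Proof.
split=> [gA | [[-> -> d0] [pc pd qc]]].
  have [ea eb] : a = 1 /\ b = 0.
    by apply: Aut_row1 gA; case: tr1 => ->; [left | right]; rewrite addr0.
  case/Aut_mx22P: gA => D0 [_ _ _ x22] [y11 _ _ y22]; subst a b; split.
    by split=> //; rewrite -(det_1_0_c_d c).
  by split; [from y22 | from ((-1) *' x22) | from ((-1) *' y11)].
apply/Aut_mx22P; split; first by rewrite det_1_0_c_d.
  by split; [from ((- c) *' pc) | from ((- d) *' pc) | from ((- d) *' pc) |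
             from ((-1) *' pd)].
by split; [from ((-1) *' qc) | ring | ring | from pc].
Qed.

Lemma Der_lowerP a b c d : Der (sc_mx p1 0 0 p4 q1 q2 q3 0) (mx22 a b c d) <->
  [/\ a = 0 & b = 0] /\
  [/\ p4 * c = 0, p4 * d = 0 & (q2 + q3 - p1) * c = d * q1].
Proof.
split=> [DA | [[-> ->] [pc pd qc]]].
  have [ea eb] : a = 0 /\ b = 0.
    by apply: Der_row1 DA; case: tr1 => ->; [left | right]; rewrite addr0.
  case/Der_mx22P: DA => [[_ _ _ x22] [y11 _ _ y22]]; subst a b; split=> //.
  by split; [from y22 | from x22 | from ((-1) *' y11)].
apply/Der_mx22P; split.
  by split; [ring | from ((-1) *' pc) | from ((-1) *' pc) | from (pd)].
by split; [from ((-1) *' qc) | ring | ring | from pc].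
Qed.

End LowerTriangular.

Section Square1.
Variables p1 p4 q2 q3 : F.
Hypothesis tr1 : p1 + q2 = 1 \/ p1 + q3 = 1.
Hypothesis p4n0 : p4 != 0.

Lemma Aut_lower_q1_eq1 : Aut (sc_mx p1 0 0 p4 1 q2 q3 0) = [set 1%:M].
Proof.
rewrite mx22_1; apply: eq_mx22_set => a b c d; rewrite Aut_lowerP //.
split=> [[[-> -> _] [/mulf_eq0l-/(_ p4n0) -> _ qc]] | /mx22_inj[-> -> -> ->]].
  by congr mx22; from ((-1) *' qc).
by (split; split); rewrite ?oner_eq0 //; ring.
Qed.

Lemma Der_lower_q1_eq1 : Der (sc_mx p1 0 0 p4 1 q2 q3 0) = [set 0].
Proof.
rewrite mx22_0; apply: eq_mx22_set => a b c d; rewrite Der_lowerP //.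
split=> [[[-> ->] [/mulf_eq0l-/(_ p4n0) -> /mulf_eq0l-/(_ p4n0) -> _]] //|].
by move=> /mx22_inj[-> -> -> ->]; (split; split); ring.
Qed.

Lemma Aut_lower_q1_eq0 :
  Aut (sc_mx p1 0 0 p4 0 q2 q3 0) = [set mx22 1 0 0 1; mx22 1 0 0 (- 1)].
Proof.
apply: eq_mx22_set => a b c d; rewrite Aut_lowerP //.
split=> [[[-> -> _] [/mulf_eq0l-/(_ p4n0) -> /mulf_eq0l-/(_ p4n0)]] | ].
  by case/sqr_eq1=> -> _; [left | right].
by case=> /mx22_inj[-> -> -> ->]; (split; split);
  rewrite ?oner_eq0 ?oppr1_neq0 //; ring.
Qed.

Lemma Der_lower_q1_eq0 : Der (sc_mx p1 0 0 p4 0 q2 q3 0) = [set 0].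
Proof.
rewrite mx22_0; apply: eq_mx22_set => a b c d; rewrite Der_lowerP //.
split=> [[[-> ->] [/mulf_eq0l-/(_ p4n0) -> /mulf_eq0l-/(_ p4n0) -> _]] //|].
by move=> /mx22_inj[-> -> -> ->]; (split; split); ring.
Qed.
End Square1.

Section Square0.
Variables p1 q2 q3 : F.
Hypothesis tr1 : p1 + q2 = 1 \/ p1 + q3 = 1.

Lemma Aut_lower_c_eq0 : q2 + q3 - p1 != 0 ->
  Aut (sc_mx p1 0 0 0 0 q2 q3 0) =
    [set g | exists d : F, d != 0 /\ g = mx22 1 0 0 d].
Proof.
move=> n0; apply: eq_mx22_set => a b c d; rewrite Aut_lowerP //.
rewrite mulr0; split=> [[[-> -> d0] [_ _ /mulf_eq0l-/(_ n0) ->]] | ].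
  by exists d.
by case=> e [e0 /mx22_inj[-> -> -> ->]]; (split; split)=> //; ring.
Qed.

Lemma Der_lower_c_eq0 : q2 + q3 - p1 != 0 ->
  Der (sc_mx p1 0 0 0 0 q2 q3 0) = [set D | exists d : F, D = mx22 0 0 0 d].
Proof.
move=> n0; apply: eq_mx22_set => a b c d; rewrite Der_lowerP //.
rewrite mulr0; split=> [[[-> ->] [_ _ /mulf_eq0l-/(_ n0) ->]] | ].
  by exists d.
by case=> e /mx22_inj[-> -> -> ->]; (split; split)=> //; ring.
Qed.

Lemma Aut_lower_c_free : q2 + q3 - p1 = 0 ->
  Aut (sc_mx p1 0 0 0 0 q2 q3 0) =
    [set g | exists c d : F, d != 0 /\ g = mx22 1 0 c d].
Proof.
move=> e0; apply: eq_mx22_set => a b c d; rewrite Aut_lowerP // e0.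
split=> [[[-> -> d0] _] | [c' [d' [d0 /mx22_inj[-> -> -> ->]]]]].
  by exists c, d.
by (split; split)=> //; ring.
Qed.

Lemma Der_lower_c_free : q2 + q3 - p1 = 0 ->
  Der (sc_mx p1 0 0 0 0 q2 q3 0) = [set D | exists c d : F, D = mx22 0 0 c d].
Proof.
move=> e0; apply: eq_mx22_set => a b c d; rewrite Der_lowerP // e0.
split=> [[[-> ->] _] | [c' [d' /mx22_inj[-> -> -> ->]]]].
  by exists c, d.
by (split; split)=> //; ring.
Qed.
End Square0.

Lemma Aut_A5 a1 : Aut (A5_3 a1) = [set g | exists c : F, g = mx22 1 0 c 1].
Proof.
apply: eq_mx22_set => a b c d; rewrite Aut_lowerP; last by right; ring.
split=> [[[-> -> d0] [_ _ qc]] | [c' /mx22_inj[-> -> -> ->]]].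
  by exists c; congr mx22; from ((-1) *' qc).
by (split; split); rewrite ?oner_eq0 //; ring.
Qed.

Lemma Der_A5 a1 : Der (A5_3 a1) = [set D | exists c : F, D = mx22 0 0 c 0].
Proof.
apply: eq_mx22_set => a b c d; rewrite Der_lowerP; last by right; ring.
split=> [[[-> ->] [_ _ qc]] | [c' /mx22_inj[-> -> -> ->]]].
  by exists c; congr mx22; from ((-1) *' qc).
by (split; split); ring.
Qed.

Section FourthEighth.
Variables q1 q2 q3 : F.
Hypothesis tr1 : q2 = 1 \/ q3 = 1.

(** A trace form determines the first row of [g], and the image of [e1 e2] the
    second. *)
Lemma Aut_A4_A8 : Aut (sc_mx 0 1 1 0 q1 q2 q3 (- 1)) = [set 1%:M].
Proof.
rewrite mx22_1; apply: eq_mx22_set => a b c d.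
split=> [gA | /mx22_inj[-> -> -> ->]].
  have [ea eb] : a = 1 /\ b = 0.
    by apply: Aut_row1 gA; case: tr1 => ->; [left | right]; split; ring.
  case/Aut_mx22P: gA => _ [_ x12 _ _] [_ y12 _ _]; subst a b.
  have ed : d = 1 by from ((-1) *' x12).
  by subst d; congr mx22; from ((-1) *' y12).
by in_Aut; rewrite det_1_0_c_d oner_eq0.
Qed.

Lemma Der_A4_A8 : Der (sc_mx 0 1 1 0 q1 q2 q3 (- 1)) = [set 0].
Proof.
rewrite mx22_0; apply: eq_mx22_set => a b c d.
split=> [DA | /mx22_inj[-> -> -> ->]].
  have [ea eb] : a = 0 /\ b = 0.
    by apply: Der_row1 DA; case: tr1 => ->; [left | right]; split; ring.
  case/Der_mx22P: DA => [[_ x12 _ _] [_ y12 _ _]]; subst a b.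
  have ed : d = 0 by from ((-1) *' x12).
  by subst d; congr mx22; from ((-1) *' y12).
by in_Der.
Qed.
End FourthEighth.

(** * Algebras with zero trace forms *)

Lemma Aut_A9_0 : Aut (A9_3 (0 : F)) = [set g | exists b : F, g = mx22 1 b 0 1].
Proof.
apply: eq_mx22_set => a b c d; split; last first.
  case=> [b' /mx22_inj[-> -> -> ->]]; in_Aut.
  by rewrite mulr1 mulr0 subr0 oner_eq0.
case/Aut_mx22P=> D0 [_ _ _ x22] [y11 _ _ y22].
have /eqP : c ^+ 2 = 0 by from y11.
rewrite sqrf_eq0 => /eqP ec; subst c.
have d0 : d != 0 by apply: contraNneq D0 => ->; rewrite !mulr0 subr0.
have ed : d = 1 by apply: (mulfI d0); from y22.
by subst d; exists b; congr mx22; from x22.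
Qed.

(** The invariance of [- det L_u = b1 x^2 + b1 x y + y^2], on [e1], on [e2] and,
    polarized, on the pair [(e1, e2)]. *)
Lemma A9_form b1 a b c d : Aut (A9_3 b1) (mx22 a b c d) ->
  [/\ b1 * a ^+ 2 + b1 * a * c + c ^+ 2 = b1,
      b1 * b ^+ 2 + b1 * b * d + d ^+ 2 = 1 &
      2 * b1 * a * b + b1 * (a * d + b * c) + 2 * c * d = b1].
Proof.
move=> /Aut_det inv.
move: (inv 1 0) (inv 0 1) (inv 1 1) => /= t10 t01 t11; split.
- by from ((-1) *' t10).
- by from ((-1) *' t01).
- by from (t10 +' t01 +' (-1) *' t11).
Qed.

Lemma inv2 : 2^-1 = 2 :> F.
Proof.
have e : 2 * 2 = 1 :> F by ring3.
have n : (2 : F) != 0.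
  by apply: contra_eqN e => /eqP->; rewrite mul0r eq_sym oner_eq0.
by apply: (mulfI n); rewrite divff // e.
Qed.

(** At [b1 = 1] the invariant form degenerates to the square of [x - y], so
    [g] preserves [x - y] up to sign. *)
Lemma Aut_A9_1 : Aut (A9_3 (1 : F)) =
  [set g | exists d : F, g = mx22 ((1 + d) / 2) ((1 - d) / 2) (1 - d) d].
Proof.
apply: eq_mx22_set => a b c d; rewrite /= inv2; split; last first.
  case=> [d' /mx22_inj[-> -> -> ->]]; in_Aut.
  have -> : (1 + d') * 2 * d' - (1 - d') * 2 * (1 - d') = 1 by ring3.
  exact: oner_neq0.
move=> gA; have [eP eQ eR] := A9_form gA.
case/Aut_mx22P: gA => D0 [x11 _ _ x22] [_ _ _ y22].
have /sqr_eq1 : (a - c) ^+ 2 - 1 = 0 by from eP.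
case=> t.
  have ed : d = b + 1 by from (eR +' (b - d) *' t).
  have ea : a = c + 1 by from t.
  have eb : b = - c by subst a; from x11.
  by exists d; subst a d b; congr mx22; ring3.
(* the sign -1 is excluded by the equations for [e2 e2] *)
have ed : d = b - 1 by from ((-1) *' eR +' (d - b) *' t).
have ea : a = c - 1 by from t.
have eb : b = c by subst a; from x11.
subst a d b; have /eqP : (1 : F) = 0 by from ((-1) *' x22 +' y22).
by rewrite oner_eq0.
Qed.

Lemma Aut_A9 b1 : b1 != 0 -> b1 != 1 ->
  Aut (A9_3 b1) = [set 1%:M] `|`
    [set g | exists d : F,
       [/\ d != 0, d != 1, b1 = (d ^+ 3 - 1) / d ^+ 3 &
           g = mx22 (- d) (- d * (1 + d) / (1 + 2 * d))
                    ((2 * d ^+ 2 - d - 1) / d) d]].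
Proof.
move=> b10 b11; rewrite mx22_1; apply: eq_mx22_set => a b c d.
split; last first.
  case=> [/mx22_inj[-> -> -> ->] | [e [e0 e1 b1E /mx22_inj[-> -> -> ->]]]].
    by in_Aut; rewrite mulr1 mulr0 subr0 oner_eq0.
  have e1' : 1 - e != 0 by rewrite subr_eq0 eq_sym.
  have -> : 1 + 2 * e = 1 - e by ring3.
  have -> : 2 * e ^+ 2 - e - 1 = - (1 - e) ^+ 2 by ring3.
  have {}b1E : b1 = - (1 - e) ^+ 3 / e ^+ 3.
    by rewrite b1E; congr (_ / _); ring3.
  apply/Aut_mx22P; split.
  - have -> : - e * e - - e * (1 + e) / (1 - e) * (- (1 - e) ^+ 2 / e) = - 1.
      by field; rewrite e0 e1'.
    exact: oppr1_neq0.
  - rewrite b1E; split; field3; by rewrite ?e0 ?e1'.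
  - rewrite b1E; split; field3; by rewrite ?e0 ?e1'.
move=> gA; have [eP eQ eR] := A9_form gA.
case/Aut_mx22P: gA => D0 [x11 _ _ x22] [y11 _ _ y22].
(* [b1 - b1 ^ 2] is, up to sign, the discriminant of the invariant form,
   which a change of variables multiplies by the square of its determinant *)
have b1b1 : b1 - b1 ^+ 2 != 0.
  by rewrite -[X in X - _]mulr1 -mulrBr mulf_neq0 // subr_eq0 eq_sym.
have /(mulf_eq0l b1b1)/sqr_eq1 :
    (b1 - b1 ^+ 2) * ((a * d - b * c) ^+ 2 - 1) = 0.
  set P := _ + _ + _ in eP; set Q := _ + _ + _ in eQ; set R := _ + _ + _ in eR.
  have : 4 * P * Q - R ^+ 2 = (4 * b1 - b1 ^+ 2) * (a * d - b * c) ^+ 2.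
    by rewrite /P /Q /R; ring.
  by rewrite eP eQ eR => e; from ((-1) *' e).
case=> eD.
  (* the first row of [M g = (adj g)^T M] *)
  left; have ed : d = a + c.
    apply: (mulfI b10).
    by from (2 * d *' eP +' (- c) *' eR +' (- (2 * b1 * a + b1 * c)) *' eD).
  have ec : c = - (b1 * b).
    by from ((- d) *' eR +' 2 * c *' eQ +' (2 * b1 * b + b1 * d) *' eD).
  suff [ea e0] : a = 1 /\ c = 0.
    have eb : b = 0 by apply: (mulfI b10); rewrite e0 in ec; from ec.
    by rewrite ed ea eb e0 addr0.
  have /eqP : c * (c - a + 1) = 0 by from ((-1) *' x11 +' ec).
  rewrite mulf_eq0 => /orP[] /eqP e.
    subst c; split=> //.
    have a0 : a != 0.
      by apply: contraNneq D0 => a0; rewrite ed a0 e addr0 !mulr0 subr0.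
    apply: (mulfI a0); apply: (mulfI b10).
    by rewrite ed e in y11 *; from ((-1) *' y11).
  have ec' : c = a - 1 by from e.
  have /eqP : (b1 - 1) * (a - 1) ^+ 2 = 0.
    by rewrite ed ec' in y11; from ((-1) *' y11).
  rewrite mulf_eq0 subr_eq0 (negPf b11) sqrf_eq0 subr_eq0 => /eqP ea.
  by rewrite ec' ea subrr.
right; exists d.
(* the first row of [M g = - (adj g)^T M] *)
have ea : a = - d.
  apply: (mulfI b10).
  by from (2 * d *' eP +' (- c) *' eR +' (- (2 * b1 * a + b1 * c)) *' eD).
have ec : c = b1 * (b + d).
  by from ((- d) *' eR +' 2 * c *' eQ +' (2 * b1 * b + b1 * d) *' eD).
subst a.
have e1 : c * (1 - d) = b1 * d ^+ 2 by from (ec +' x11 +' y11).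
have d0 : d != 0.
  apply: contraNneq D0 => e; rewrite e in e1 *.
  by rewrite [c](_ : _ = 0) ?oppr0 ?mul0r ?mulr0 ?subr0 //; from e1.
have d1 : d != 1.
  apply: contraNneq b10 => e; rewrite e in e1.
  by apply/eqP; from ((-1) *' e1).
have d1' : 1 - d != 0 by rewrite subr_eq0 eq_sym.
have d2 : 1 + 2 * d != 0 by have -> : 1 + 2 * d = 1 - d by ring3.
have cd : c * d = 2 * d ^+ 2 - d - 1.
  apply: (mulfI b10).
  by from ((- c) *' ec +' b1 *' eD +' y11).
have bE : b * (1 + 2 * d) = - d * (1 + d).
  apply: (mulfI d1').
  by from (d *' eD +' b *' cd).
split=> //.
  apply: (mulIf (expf_neq0 3 d0)); rewrite divfK ?expf_neq0 //.
  by from ((-d) *' e1 +' (1 - d) *' cd).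
congr mx22.
  by apply: (mulIf d2); rewrite divfK.
by apply: (mulIf d0); rewrite divfK.
Qed.

(** The parameter [d] of the second family in [Aut_A9] satisfies
    [d ^ 3 = 1 / (1 - b1)], which is -1 here; the only cube root of -1 is
    [-1 = 2]. *)
Lemma Aut_A9_2 : Aut (A9_3 (2 : F)) = [set 1%:M; mx22 1 0 1 2].
Proof.
have n20 : (2 : F) != 0.
  apply/eqP=> e; have /eqP : (1 : F) = 0 by from ((-1) *' e).
  by rewrite oner_eq0.
have n21 : (2 : F) != 1.
  by rewrite -subr_eq0; have -> : 2 - 1 = 1 :> F by [ring]; rewrite oner_eq0.
apply/seteqP; split=> g /=.
  rewrite Aut_A9 // => -[|[d [d0 _ e gE]]]; [by left | right; rewrite gE].
  have /eqP : (d - 2) ^+ 3 = 0.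
    have e3 : 2 * d ^+ 3 = d ^+ 3 - 1 by rewrite e divfK // expf_neq0.
    by from e3.
  rewrite expf_eq0 /= subr_eq0 => /eqP ->; congr mx22.
  - by ring3.
  - by have -> : 1 + 2 = 0 :> F by [ring3]; rewrite mulr0 mul0r.
  - by apply: (mulIf n20); rewrite divfK //; ring3.
case=> ->; first by rewrite Aut_A9 //; left.
in_Aut; by rewrite mul1r mul0r subr0.
Qed.

Lemma Der_A9 b1 : Der (A9_3 b1) =
  [set D | exists b : F, D = mx22 (2 * b * b1) b (2 * b * b1) (b * b1)].
Proof.
apply: eq_mx22_set => a b c d.
split=> [|[b' /mx22_inj[-> -> -> ->]]]; last by in_Der.
case/Der_mx22P=> [[x11 x12 _ x22] [_ y12 _ y22]]; exists b.
have ec : c = - d by from ((-1) *' x12).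
have ed : d = b * b1 by subst c; from ((-1) *' x11).
by subst c d; congr mx22; [from x22 | ring3].
Qed.

Lemma Aut_A10 b1 : b1 != 0 -> Aut (A10_3 b1) =
  [set g | exists a : F, a ^+ 3 = 1 /\ g = mx22 a 0 0 (a ^+ 2)] `|`
  [set g | exists b : F, [/\ b != 0, b ^- 3 = b1 & g = mx22 0 b (1 / b) 0]].
Proof.
move=> b1n0; apply: eq_mx22_set => a b c d; split.
  case/Aut_mx22P=> D0 [x11 x12 _ x22] [y11 y12 _ y22].
  have /eqP : c * d = 0 by from ((-1) *' x12).
  rewrite mulf_eq0 => /orP[] /eqP e0; subst; [left | right].
    have eb : b = 0 by apply: (mulfI b1n0); from x11.
    have ed : d = a ^+ 2 by apply: (mulfI b1n0); from y11.
    subst b d; exists a; split=> //.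
    have a0 : a != 0 by apply: contraNneq D0 => ->; rewrite !mul0r subr0.
    by apply: (mulfI a0); from ((-1) *' x22).
  have ea : a = 0 by from (x22).
  subst a; have b0 : b != 0 by apply: contraNneq D0 => ->; rewrite !mul0r subr0.
  have e1 : b1 * b ^+ 3 = 1.
    have n : b1 * b != 0 by rewrite mulf_neq0.
    have ec : c = b1 * b ^+ 2 by from y22.
    by apply: (mulfI n); subst c; from ((-1) *' x11).
  exists b; split=> //.
    by rewrite -[b1]mulr1 -(divff (expf_neq0 3 b0)) mulrA e1 mul1r.
  congr mx22; rewrite mul1r; apply: (mulIf b0); rewrite mulVf //.
  by from (e1 +' b *' y22).
case=> [[a' [a3 /mx22_inj[-> -> -> ->]]] | [b' [b0 bE /mx22_inj[-> -> -> ->]]]];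
  apply/Aut_mx22P.
  split.
  - by apply: contra_eqN a3 => /eqP e; rewrite [X in X == _](_ : _ = 0);
      [rewrite eq_sym oner_eq0 | from e].
  - by split; first [ring3 | from ((- a') *' a3)].
  - by split; first [ring3 | from ((- a') *' a3)].
have bV : b' * (1 / b') = 1 by rewrite mul1r divff.
split.
- by rewrite bV mulr0 sub0r oppr1_neq0.
- rewrite -bE; split; field: h3; done.
- rewrite -bE; split; field: h3; done.
Qed.

Lemma Aut_A10_0 : Aut (A10_3 (0 : F)) =
  [set g | exists b d : F, d != 0 /\ g = mx22 (d ^+ 2) b 0 d].
Proof.
apply: eq_mx22_set => a b c d; split; last first.
  case=> [b' [d' [d0 /mx22_inj[-> -> -> ->]]]]; in_Aut.
  by rewrite mulr0 subr0 mulf_neq0 ?expf_neq0.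
case/Aut_mx22P=> D0 [x11 _ _ x22] _.
have /eqP : c ^+ 2 = 0 by from ((-1) *' x11).
rewrite sqrf_eq0 => /eqP ec; subst c.
have d0 : d != 0 by apply: contraNneq D0 => ->; rewrite !mulr0 subr0.
by exists b, d; split=> //; congr mx22; from x22.
Qed.

Lemma Der_A10 b1 : b1 != 0 ->
  Der (A10_3 b1) = [set D | exists a : F, D = mx22 a 0 0 (- a)].
Proof.
move=> b1n0; apply: eq_mx22_set => a b c d.
split=> [|[a' /mx22_inj[-> -> -> ->]]]; last by in_Der.
case/Der_mx22P=> [[x11 x12 _ x22] [_ y12 _ y22]]; exists a.
congr mx22; [ | by from (y22) | by from x22].
by apply: (mulfI b1n0); from x11.
Qed.

Lemma Der_A10_0 :
  Der (A10_3 (0 : F)) = [set D | exists a b : F, D = mx22 a b 0 (- a)].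
Proof.
apply: eq_mx22_set => a b c d.
split=> [|[a' [b' /mx22_inj[-> -> -> ->]]]]; last by in_Der.
case/Der_mx22P=> [[_ _ _ x22] [_ _ _ y22]]; exists a, b.
by congr mx22; [from y22 | from x22].
Qed.

Lemma Aut_A11 b1 : b1 != 0 ->
  Aut (A11_3 b1) = [set mx22 1 0 0 1; mx22 (- 1) 0 0 1].
Proof.
move=> b1n0; apply: eq_mx22_set => a b c d; split; last first.
  by case=> /mx22_inj[-> -> -> ->]; in_Aut;
    rewrite mulr1 mul0r subr0 ?oppr1_neq0 ?oner_eq0.
move=> gA; have /(_ 0 1)/= t01 := Aut_det gA.
case/Aut_mx22P: gA => _ _ [y11 y12 _ y22].
(* [b1 b ^ 2] is [1 - d ^ 2] by invariance and [d ^ 2 - d] by [e2 e2] *)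
have /eqP : (d - 1) ^+ 2 = 0 by from (t01 +' (-1) *' y22).
rewrite sqrf_eq0 subr_eq0 => /eqP ed; subst d.
have /(mulf_eq0l b1n0)/eqP : b1 * b ^+ 2 = 0 by from ((-1) *' y22).
rewrite sqrf_eq0 => /eqP eb; subst b.
have ec : c = 0 by from ((-1) *' y12).
subst c; have /(mulf_eq0l b1n0)/sqr_eq1 : b1 * (a ^+ 2 - 1) = 0.
  by from ((-1) *' y11).
by case=> ->; [left | right].
Qed.

Lemma Aut_A11_0 : Aut (A11_3 (0 : F)) =
  [set g | exists a b : F, a != 0 /\ g = mx22 a b 0 1].
Proof.
apply: eq_mx22_set => a b c d; split; last first.
  case=> [a' [b' [a0 /mx22_inj[-> -> -> ->]]]]; in_Aut.
  by rewrite mulr1 mulr0 subr0.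
case/Aut_mx22P=> D0 [_ x12 _ _] [y11 _ _ _].
have /eqP : c ^+ 2 = 0 by from y11.
rewrite sqrf_eq0 => /eqP ec; subst c.
have a0 : a != 0 by apply: contraNneq D0 => ->; rewrite !mul0r mulr0 subr0.
have ed : d = 1 by apply: (mulfI a0); from ((-1) *' x12).
by subst d; exists a, b.
Qed.

Lemma Der_A11 b1 : b1 != 0 ->
  Der (A11_3 b1) = [set D | exists c : F, D = mx22 0 (2 * c / b1) c 0].
Proof.
move=> b1n0; apply: eq_mx22_set => a b c d.
split=> [|[c' /mx22_inj[-> -> -> ->]]].
  case/Der_mx22P=> [[x11 x12 _ x22] [y11 y12 _ y22]]; exists c.
  have ed : d = 0 by from ((-1) *' x12).
  congr mx22 => //.
    by apply: (mulfI b1n0); subst d; from y11.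
  by apply: (mulfI b1n0); rewrite mulrCA divff // mulr1; from x11.
apply/Der_mx22P.
have e : b1 * (2 * c' / b1) = 2 * c' by rewrite mulrCA divff // mulr1.
by split; split; first [ring3 | from e | from ((-1) *' e)].
Qed.

Lemma Der_A11_0 :
  Der (A11_3 (0 : F)) = [set D | exists a b : F, D = mx22 a b 0 0].
Proof.
apply: eq_mx22_set => a b c d.
split=> [|[a' [b' /mx22_inj[-> -> -> ->]]]]; last by in_Der.
case/Der_mx22P=> [[x11 x12 _ x22] [y11 y12 _ y22]]; exists a, b.
congr mx22; [by from ((-1) *' y12) | by from ((-1) *' x12)].
Qed.

End Parts.

(** * Automorphisms and derivations of the eleven algebras *)

Theorem theorem3p3 (F : fieldType) (charF3 : 3%N \in [pchar F]) :
  (forall a1 a2 a4 b1 : F,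
     Aut (A1_3 a1 a2 a4 b1) = [set 1%:M] /\ Der (A1_3 a1 a2 a4 b1) = [set 0])
  /\
  (forall a1 a4 b2 : F, a4 != 0 ->
     Aut (A2_3 a1 a4 b2) = [set 1%:M] /\ Der (A2_3 a1 a4 b2) = [set 0])
  /\
  ((forall a1 a4 b2 : F, a4 != 0 ->
      Aut (A3_3 a1 a4 b2) = [set mx22 1 0 0 1; mx22 1 0 0 (- 1)] /\
      Der (A3_3 a1 a4 b2) = [set 0])
   /\
   (forall a1 b2 : F, b2 != 2 * a1 - 1 ->
      Aut (A3_3 a1 0 b2) =
        [set g | exists d : F, d != 0 /\ g = mx22 1 0 0 d] /\
      Der (A3_3 a1 0 b2) =
        [set D | exists d : F, D = mx22 0 0 0 d])
   /\
   (forall a1 : F,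
      Aut (A3_3 a1 0 (2 * a1 - 1)) =
        [set g | exists c d : F, d != 0 /\ g = mx22 1 0 c d] /\
      Der (A3_3 a1 0 (2 * a1 - 1)) =
        [set D | exists c d : F, D = mx22 0 0 c d]))
  /\
  (forall b1 b2 : F,
     Aut (A4_3 b1 b2) = [set 1%:M] /\ Der (A4_3 b1 b2) = [set 0])
  /\
  (forall a1 : F,
     Aut (A5_3 a1) = [set g | exists c : F, g = mx22 1 0 c 1] /\
     Der (A5_3 a1) = [set D | exists c : F, D = mx22 0 0 c 0])
  /\
  (forall a1 a4 : F, a4 != 0 ->
     Aut (A6_3 a1 a4) = [set 1%:M] /\ Der (A6_3 a1 a4) = [set 0])
  /\
  ((forall a1 a4 : F, a4 != 0 ->
      Aut (A7_3 a1 a4) = [set mx22 1 0 0 1; mx22 1 0 0 (- 1)] /\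
      Der (A7_3 a1 a4) = [set 0])
   /\
   (forall a1 : F,
      Aut (A7_3 a1 0) = [set g | exists d : F, d != 0 /\ g = mx22 1 0 0 d] /\
      Der (A7_3 a1 0) = [set D | exists d : F, D = mx22 0 0 0 d]))
  /\
  (forall b1 : F,
     Aut (A8_3 b1) = [set 1%:M] /\ Der (A8_3 b1) = [set 0])
  /\
  ((forall b1 : F, b1 != 0 -> b1 != 1 -> b1 != 2 ->
      Aut (A9_3 b1) =
        [set 1%:M] `|`
        [set g | exists d : F,
           [/\ d != 0, d != 1, b1 = (d ^+ 3 - 1) / d ^+ 3 &
               g = mx22 (- d) (- d * (1 + d) / (1 + 2 * d))
                        ((2 * d ^+ 2 - d - 1) / d) d]])
   /\
   Aut (A9_3 (0 : F)) = [set g | exists b : F, g = mx22 1 b 0 1]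
   /\
   Aut (A9_3 (1 : F)) =
     [set g | exists d : F, g = mx22 ((1 + d) / 2) ((1 - d) / 2) (1 - d) d]
   /\
   Aut (A9_3 (2 : F)) = [set 1%:M; mx22 1 0 1 2]
   /\
   (forall b1 : F,
      Der (A9_3 b1) =
        [set D | exists b : F, D = mx22 (2 * b * b1) b (2 * b * b1) (b * b1)]))
  /\
  ((forall b1 : F, b1 != 0 ->
      Aut (A10_3 b1) =
        [set g | exists a : F, a ^+ 3 = 1 /\ g = mx22 a 0 0 (a ^+ 2)] `|`
        [set g | exists b : F,
           [/\ b != 0, b ^- 3 = b1 & g = mx22 0 b (1 / b) 0]] /\
      Der (A10_3 b1) = [set D | exists a : F, D = mx22 a 0 0 (- a)])
   /\
   Aut (A10_3 (0 : F)) =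
     [set g | exists b d : F, d != 0 /\ g = mx22 (d ^+ 2) b 0 d]
   /\
   Der (A10_3 (0 : F)) = [set D | exists a b : F, D = mx22 a b 0 (- a)])
  /\
  ((forall b1 : F, b1 != 0 ->
      Aut (A11_3 b1) = [set mx22 1 0 0 1; mx22 (- 1) 0 0 1] /\
      Der (A11_3 b1) = [set D | exists c : F, D = mx22 0 (2 * c / b1) c 0])
   /\
   Aut (A11_3 (0 : F)) =
     [set g | exists a b : F, a != 0 /\ g = mx22 a b 0 1]
   /\
   Der (A11_3 (0 : F)) = [set D | exists a b : F, D = mx22 a b 0 0]).
Proof.
have h3 : 3 = 0 :> F := pcharf0 charF3.
split; first by move=> *; split; [apply: Aut_A1 | apply: Der_A1].
split.
  move=> a1 a4 b2 a40.
  split; [apply: Aut_lower_q1_eq1 | apply: Der_lower_q1_eq1];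
    by [| right; rewrite subrKC].
split.
  split; last split.
  - move=> a1 a4 b2 a40.
    split; [apply: Aut_lower_q1_eq0 | apply: Der_lower_q1_eq0];
      by [| right; rewrite subrKC].
  - move=> a1 b2 b2E; have n0 : b2 + (1 - a1) - a1 != 0.
      have -> : b2 + (1 - a1) - a1 = b2 - (2 * a1 - 1) by ring.
      by rewrite subr_eq0.
    split; [apply: Aut_lower_c_eq0 | apply: Der_lower_c_eq0];
      by [| right; rewrite subrKC].
  - move=> a1; have e0 : 2 * a1 - 1 + (1 - a1) - a1 = 0 by ring.
    split; [apply: Aut_lower_c_free | apply: Der_lower_c_free];
      by [| right; rewrite subrKC].
split.
  by move=> b1 b2; split; [apply: Aut_A4_A8 | apply: Der_A4_A8];
    try right.
split; first by move=> a1; split; [apply: Aut_A5 | apply: Der_A5].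
split.
  move=> a1 a4 a40; split; [apply: Aut_lower_q1_eq1 | apply: Der_lower_q1_eq1];
    by [| left; rewrite subrKC].
split.
  split.
    move=> a1 a4 a40.
    split; [apply: Aut_lower_q1_eq0 | apply: Der_lower_q1_eq0];
      by [| left; rewrite subrKC].
  move=> a1; have n0 : 1 - a1 + - a1 - a1 != 0.
    by have -> : 1 - a1 + - a1 - a1 = 1 by [ring3]; rewrite oner_eq0.
  split; [apply: Aut_lower_c_eq0 | apply: Der_lower_c_eq0];
    by [| left; rewrite subrKC].
split.
  by move=> b1; split; [apply: Aut_A4_A8 | apply: Der_A4_A8];
    try left.
split.
  split; first by move=> b1 b10 b11 _; apply: Aut_A9.
  split; first exact: Aut_A9_0.
  split; first exact: Aut_A9_1.
  by split; [apply: Aut_A9_2 | apply: Der_A9].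
split.
  split; first by move=> b1 b10; split; [apply: Aut_A10 | apply: Der_A10].
  by split; [apply: Aut_A10_0 | apply: Der_A10_0].
split; first by move=> b1 b10; split; [apply: Aut_A11 | apply: Der_A11].
by split; [apply: Aut_A11_0 | apply: Der_A11_0].
Qed.
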